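(* Let $G$ be a permutation group on a finite set $\Omega$. Assume that there are subsets $B$, $C$ of $\Omega$ and a prime $p$ such that $p\nmid |B|\,|C|$ and $p\mid |B\cap C^g|$ for all $g\in G$. Then $G$ contains no sharply transitive set of permutations.
   Context: A set $S$ of permutations of a finite set $\Omega$ is called sharply transitive on $\Omega$ if for all $x,y\in\Omega$ there is a unique $s\in S$ with $x^s=y$; $S$ need not be a subgroup. Here $x^g$ denotes the image of $x$ under $g$, and $C^g=\{c^g : c\in C\}$. *)

(* Defs.v *)
From mathcomp Require Import all_boot all_fingroup.
Set Implicit Arguments.
Unset Strict Implicit.
Unset Printing Implicit Defensive.

(* [s x] is the image of x under s, written x^s for right actions; S is an
   arbitrary set of permutations, not necessarily a subgroup. *)
Definition sharply_transitive (Omega : finType) (S : {set {perm Omega}}) : Prop :=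
  forall x y : Omega, exists! s : {perm Omega}, s \in S /\ s x = y.

(* Main.v *)
Require Import Defs.
From mathcomp Require Import all_boot all_fingroup.

(** The proof is a double count of the triples [(s, c, b)] with [s] in a
    sharply transitive set [S], [c] in [C], [b] in [B] and [s c = b].  For
    fixed [s] there are [#|B :&: s @: C|] of them; for fixed [c] and [b] there
    is exactly one, by sharp transitivity.  Hence
    [\sum_(s in S) #|B :&: s @: C| = #|B| * #|C|]
    ([sum_card_setI_imset]).  If [S] lies in [G], then [p] divides every term
    on the left, so it divides [#|B| * #|C|], contrary to hypothesis. *)

(** Since [s] is injective, each point of [B :&: s @: C] comes from exactly one
    [c], so that the intersection can be counted by pairs. *)
Lemma card_setI_imset_perm (Omega : finType) (B C : {set Omega})
    (s : {perm Omega}) :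
  #|B :&: s @: C| = \sum_(c in C) \sum_(b in B) (s c == b).
Proof.
have -> : B :&: s @: C = s @: [set c in C | s c \in B].
  apply/setP => b; apply/setIP/imsetP => [[bB /imsetP[c cC def_b]] | [c]].
    by exists c => //; rewrite inE cC -def_b.
  by rewrite inE => /andP[cC scB] ->; rewrite imset_f.
rewrite card_imset; last exact: perm_inj.
rewrite -sum1_card (eq_bigl (fun c => (c \in C) && (s c \in B))); last first.
  by move=> c; rewrite inE.
rewrite big_mkcondr; apply: eq_bigr => c _.
have [scB | scNB] := boolP (s c \in B).
  rewrite (bigD1 (s c)) //= eqxx big1 // => b /andP[_ neq_b].
  by rewrite eq_sym (negPf neq_b).
rewrite big1 // => b bB; case: eqP => // scb.
by rewrite scb bB in scNB.
Qed.

Lemma sharply_transitive_sum1 (Omega : finType) (S : {set {perm Omega}})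
    (x y : Omega) :
  sharply_transitive S -> \sum_(s in S) (s x == y) = 1.
Proof.
move=> /(_ x y)[s [[sS sxy] s_uniq]].
rewrite (bigD1 s) //= sxy eqxx big1 // => t /andP[tS neq_ts].
case: eqP => // txy.
by rewrite (s_uniq t (conj tS txy)) eqxx in neq_ts.
Qed.

Lemma sum_card_setI_imset (Omega : finType) (S : {set {perm Omega}})
    (B C : {set Omega}) :
  sharply_transitive S -> \sum_(s in S) #|B :&: s @: C| = #|B| * #|C|.
Proof.
move=> trS; under eq_bigr => s _ do rewrite card_setI_imset_perm.
rewrite exchange_big /=.
under eq_bigr => c _.
  rewrite exchange_big /=.
  under eq_bigr => b _ do rewrite sharply_transitive_sum1 //.
  rewrite sum1_card; over.
by rewrite sum_nat_const mulnC.
Qed.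

Theorem lemma2 (Omega : finType) (G : {group {perm Omega}})
    (B C : {set Omega}) (p : nat) :
  prime p ->
  ~~ (p %| #|B| * #|C|) ->
  (forall g : {perm Omega}, g \in G -> p %| #|B :&: g @: C|) ->
  ~ (exists S : {set {perm Omega}}, S \subset G /\ sharply_transitive S).
Proof.
move=> _ /negP pNBC pBC [S [sSG trS]]; apply: pNBC.
rewrite -(sum_card_setI_imset _ S) //; apply: dvdn_sum => s sS.
exact/pBC/(subsetP sSG).
Qed.
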